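(* Let $G=(V,E)$ be a finite weighted graph with vertex measure $\mu$, $k\in\mathbb{N}$, and $s$ an $S^1_k$-valued signature such that the Cheeger constant $h=h_1^s(\mu)$ is positive, and let $p\ge1$, $1/p'=1-1/p$. Then for every $f:V\to\mathbb{C}$, $$\left[\sum_{u\in V}|f(u)|^p\mu(u)\right]^{1/p}\le\frac{6p\,d_\mu^{1/p'}}{h}\left[\sum_{\{u,v\}\in E}w_{uv}|f(u)-s_{uv}f(v)|^p\right]^{1/p}.$$
   Context: $G=(V,E)$ undirected simple finite, edge weights $w_{uv}=w_{vu}>0$, $\mu:V\to(0,\infty)$; $d_u=\sum_{v\sim u}w_{uv}$, $d_\mu=\max_u d_u/\mu(u)$ (with $d_\mu^{0}=1$ when $p=1$); $|E(X,X^c)|=\sum_{u\in X,v\notin X}w_{uv}$, $\mathrm{vol}_\mu(X)=\sum_{u\in X}\mu(u)$. $S^1_k=\{e^{2\pi ij/k}\}$; a signature is $s:E^{or}\to S^1_k$ with $s_{vu}=s_{uv}^{-1}$. For nonempty $V_1$ with induced edges $E_1$, $\iota^s(V_1)=\min_{\tau:V_1\to S^1_k}\sum_{\{u,v\}\in E_1}w_{uv}|\tau(u)-s_{uv}\tau(v)|$. $h_1^s(\mu)=\min_{\emptyset\ne V_1\subseteq V}\frac{\iota^s(V_1)+|E(V_1,V_1^c)|}{\mathrm{vol}_\mu(V_1)}$. *)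

(* Defs.v *)
From mathcomp Require Import all_boot all_order all_algebra.
From mathcomp Require Import all_classical all_reals all_analysis.
From mathcomp.real_closed Require Import complex.

Set Implicit Arguments.
Unset Strict Implicit.
Unset Printing Implicit Defensive.

Import Order.TTheory GRing.Theory Num.Theory.
Local Open Scope ring_scope.
Local Open Scope classical_set_scope.

(* A finite weighted graph is given by an adjacency relation [adj] on a finite
   type [V] and weights [w : V -> V -> R]; only the values of [w] on adjacent
   pairs are ever used. *)

Definition simple_graph (V : finType) (adj : rel V) : Prop :=
  symmetric adj /\ irreflexive adj.

Definition edge_weight (R : realType) (V : finType) (adj : rel V)
    (w : V -> V -> R) : Prop :=
  forall u v, adj u v -> 0 < w u v /\ w u v = w v u.

(* The sum of [F] over the undirected edges {u, v}: each edge is counted once,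
   oriented by the enumeration of [V]. In every use below [F u v = F v u] on
   edges, so the choice of orientation is immaterial. *)
Definition edge_sum (R : realType) (V : finType) (adj : rel V)
    (F : V -> V -> R) : R :=
  \sum_(u : V) \sum_(v : V | adj u v && (enum_rank u < enum_rank v)%N) F u v.

Definition degree (R : realType) (V : finType) (adj : rel V)
    (w : V -> V -> R) (u : V) : R :=
  \sum_(v : V | adj u v) w u v.

(* The starting value 0 is harmless: the ratios are nonnegative. *)
Definition max_degree (R : realType) (V : finType) (adj : rel V)
    (w : V -> V -> R) (mu : V -> R) : R :=
  \big[Num.max/0]_(u : V) (degree adj w u / mu u).

Definition boundary (R : realType) (V : finType) (adj : rel V)
    (w : V -> V -> R) (X : {set V}) : R :=
  \sum_(u in X) \sum_(v | (v \notin X) && adj u v) w u v.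

Definition vol (R : realType) (V : finType) (mu : V -> R) (X : {set V}) : R :=
  \sum_(u in X) mu u.

(* exp (2 pi i j / k) for j = 0, ..., k - 1 *)
Definition roots1 (R : realType) (k : nat) : set R[i] :=
  [set Complex (cos (2 * pi * j%:R / k%:R)) (sin (2 * pi * j%:R / k%:R))
    | j in [set j : nat | (j < k)%N]].
Arguments roots1 {R} k.

Definition signature (R : realType) (V : finType) (adj : rel V) (k : nat)
    (s : V -> V -> R[i]) : Prop :=
  forall u v, adj u v -> roots1 k (s u v) /\ s v u = (s u v)^-1.

(* A function V1 -> S^1_k is represented by a function on [V] whose values on
   V1 lie in S^1_k; its values outside V1 do not matter. For 0 < k the set of
   values is finite and nonempty, so that [inf] is its minimum. *)
Definition frustration (R : realType) (V : finType) (adj : rel V)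
    (w : V -> V -> R) (k : nat) (s : V -> V -> R[i]) (V1 : {set V}) : R :=
  inf [set edge_sum [rel u v | [&& u \in V1, v \in V1 & adj u v]]
             (fun u v => w u v * Normc.normc (tau u - s u v * tau v))
      | tau in [set tau : V -> R[i] | forall u, u \in V1 -> roots1 k (tau u)]].

(* The set of values is finite, and nonempty as soon as [V] is, so that [inf] is
   its minimum. If [V] is empty, then [cheeger1] is [inf set0 = 0]. *)
Definition cheeger1 (R : realType) (V : finType) (adj : rel V)
    (w : V -> V -> R) (mu : V -> R) (k : nat) (s : V -> V -> R[i]) : R :=
  inf [set (frustration adj w k s V1 + boundary adj w V1) / vol mu V1
      | V1 in [set V1 : {set V} | V1 != finset.set0]].

(* Main.v *)
(* Write [f = r e] with [r = |f|] and [|e| = 1]. For a fixed [tau : V -> S^1_k],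
   summing [h vol(X) <= iota(X) + |E(X, X^c)|] over the superlevel sets of [r]
   bounds [h sum r mu] by the sum over the edges of
   [w (|r u - r v| + min (r u) (r v) |tau u - s tau v|)]. Let [tau] round [e] to a
   [k]-th root of unity and average over the rotations of the rounding sectors:
   the mean of [|tau u - s tau v|] is at most the angle between [e u] and
   [s (e v)], hence at most [2 |e u - s (e v)|], while
   [min (r u) (r v) |e u - s (e v)| <= 2 |f u - s (f v)|]. This gives the case
   [p = 1] with constant [5]. The general case follows by applying it to
   [f |f|^(p - 1)] and using Hoelder's inequality. *)

Require Import Defs.
From mathcomp Require Import all_boot all_order all_algebra.
From mathcomp Require Import all_classical all_reals all_analysis.
From mathcomp.real_closed Require Import complex.
From mathcomp Require Import ring lra zify.

Import Order.TTheory GRing.Theory Num.Theory.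
Import numFieldNormedType.Exports.
Local Open Scope ring_scope.

Set Implicit Arguments.
Unset Strict Implicit.

Local Notation normc := Normc.normc.

(** * Complex exponentials *)

Definition expi (R : realType) (t : R) : R[i] := Complex (cos t) (sin t).

Lemma expiD (R : realType) (a b : R) : expi (a + b) = expi a * expi b.
Proof. by rewrite /expi sinD cosD; simpc; rewrite [cos a * sin b + _]addrC. Qed.

Lemma normc_expi (R : realType) (a : R) : normc (expi a) = 1.
Proof. by rewrite /normc /expi cos2Dsin2 sqrtr1. Qed.

Lemma expi_nat (R : realType) (n : nat) : expi (2 * pi * n%:R) = 1 :> R[i].
Proof.
elim: n => [|n IHn]; first by rewrite mulr0 /expi cos0 sin0.
rewrite -(natr1 n) mulrDr mulr1 expiD IHn mul1r mulr_natl /expi.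
by rewrite cos2pi sin2pi.
Qed.

Lemma expi_int (R : realType) (n : int) : expi (2 * pi * n%:~R) = 1 :> R[i].
Proof.
case: n => n; first exact: expi_nat.
have h := @expi_nat R n.+1; rewrite NegzE mulrNz mulrN.
rewrite -[LHS]mulr1 -{1}h -expiD addrC subrr /expi.
by rewrite cos0 sin0.
Qed.

Lemma sin_le_arg (R : realType) (x : R) : 0 <= x -> `|sin x| <= x.
Proof.
rewrite le_eqVlt => /predU1P[<-|x0]; first by rewrite sin0 normr0.
have [|c _] := @MVT R sin cos 0 x x0.
  by apply: continuous_subspaceT => z; exact: continuous_sin.
rewrite sin0 !subr0 => ->; rewrite normrM (gtr0_norm x0).
by rewrite ler_piMl ?cos_max ?(ltW x0).
Qed.

(** The chord formula: once the rotation [expi b] is factored out, the square of what remains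
    reduces to [4 * sin y ^+ 2], where [y] is half the angle. *)
Lemma normc_expiB (R : realType) (a b : R) :
  normc (expi a - expi b) = 2 * `|sin ((a - b) / 2)|.
Proof.
have -> : a = b + (a - b) / 2 + (a - b) / 2 by field.
set y := (a - b) / 2.
have -> : (b + y + y - b) / 2 = y by field.
rewrite !expiD -mulrA -[X in _ - X]mulr1 -mulrBr Normc.normcM normc_expi mul1r.
rewrite /normc /expi; simpc.
rewrite -(sqrtr_sqr (sin y)) -[2](ger0_norm (ler0n R 2)) -sqrtr_sqr -sqrtrM ?sqr_ge0//.
congr Num.sqrt.
have := cos2Dsin2 y; move: (cos y) (sin y) => c s h.
have {}h : c ^+ 2 = 1 - s ^+ 2 by rewrite -h addrK.
rewrite -!expr2 h.
have -> : (c * s + s * c) ^+ 2 = 4 * c ^+ 2 * s ^+ 2 by ring.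
rewrite h; ring.
Qed.

Lemma normc_expiB_le (R : realType) (a b : R) :
  normc (expi a - expi b) <= `|a - b|.
Proof.
wlog ab : a b / b <= a.
  move=> H; have /orP[/H//|/H] := le_total b a.
  by rewrite -normcN opprB distrC.
rewrite normc_expiB (ger0_norm (x := a - b)) ?subr_ge0//.
have : `|sin ((a - b) / 2)| <= (a - b) / 2 by apply: sin_le_arg; lra.
lra.
Qed.

(* With [y = x / 2] and [sin y = y cos c] for some [c < y], one has
   [sin x = 2 sin y cos y >= x (cos y)^2 = x (1 + cos x) / 2]. *)
Lemma sin_ge_half (R : realType) (x : R) : 0 <= x <= pi / 2 -> x / 2 <= sin x.
Proof.
move=> /andP[]; rewrite le_eqVlt => /predU1P[<- _|x0 xpi].
  by rewrite mul0r sin0.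
have z0 : 0 < x / 2 by lra.
have [|c cI] := @MVT R sin cos 0 (x / 2) z0.
  by apply: continuous_subspaceT => z; exact: continuous_sin.
rewrite sin0 !subr0 => sE.
move: cI; rewrite in_itv/= => /andP[c0 cz].
have cosx : 0 <= cos x by apply: cos_ge0_pihalf; have := @pi_ge0 R; lra.
have cosz : 0 <= cos (x / 2) by apply: cos_ge0_pihalf; have := @pi_ge0 R; lra.
have zc : cos (x / 2) <= cos c.
  by apply: ltW; rewrite ltr_cos// in_itv/=; have := @pi_ge0 R; lra.
have xE : x = x / 2 *+ 2 by rewrite mulr2n; lra.
move: cosx; rewrite {1}xE cos_mulr2n [in sin x]xE sin_mulr2n sE.
move: zc cosz; move: (cos _) (cos _) => D C CD C0 h.
have : x * (2 * (C * C)) <= x * (2 * (C * D)) 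
  by rewrite ler_pM2l// ler_pM2l ?ltr0n// ler_wpM2l.
have : x * 1 <= x * (2 * (C * C)) by rewrite ler_pM2l//; move: h; rewrite expr2 mulr2n; lra.
move=> h1 h2; lra.
Qed.

(** Up to half a turn, arc and chord are comparable. The sharp factor is [pi / 2]; the factor 2
    comes from the cruder bound [sin_ge_half]. *)
Lemma normc_expiB_ge (R : realType) (a b : R) :
  `|a - b| <= pi -> `|a - b| <= 2 * normc (expi a - expi b).
Proof.
wlog ab : a b / b <= a.
  move=> H; have /orP[/H//|/H] := le_total b a.
  by rewrite -normcN opprB distrC.
rewrite normc_expiB (ger0_norm (x := a - b)) ?subr_ge0// => h.
have : (a - b) / 2 / 2 <= sin ((a - b) / 2) by apply: sin_ge_half; apply/andP; split; lra.
have := ler_norm (sin ((a - b) / 2)); lra.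
Qed.

(** * Polar form and estimates for the modulus *)

Lemma polar (R : realType) (z : R[i]) :
  exists t : R, z = (normc z)%:C%C * expi t.
Proof.
case: z => x y; set r := normc _.
have r0 : 0 <= r by rewrite sqrtr_ge0.
have rE : r ^+ 2 = x ^+ 2 + y ^+ 2 by rewrite sqr_sqrtr// addr_ge0 ?sqr_ge0.
have [r00|rn0] := eqVneq r 0.
  exists 0; rewrite r00 mul0r; apply: Normc.eq0_normc.
  exact: r00.
have rp : 0 < r by rewrite lt_def rn0.
have xr : -1 <= x / r <= 1.
  rewrite -ler_norml normrM normfV (gtr0_norm rp) ler_pdivrMr// mul1r.
  rewrite -(ler_pXn2r (n := 2)) ?nnegrE// -normrX ger0_norm ?sqr_ge0//.
  by rewrite rE lerDl sqr_ge0.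
have c1 : r * cos (acos (x / r)) = x by rewrite acosK ?in_itv//= mulrC divfK.
have s1 : r * sin (acos (x / r)) = `|y|.
  rewrite sin_acos// -{1}(gtr0_norm rp) -sqrtr_sqr -sqrtrM ?sqr_ge0//.
  rewrite -sqrtr_sqr; congr Num.sqrt.
  by rewrite mulrBr mulr1 -exprMn (mulrC r) divfK// rE; ring.
(* [acos] only yields angles of the upper half-plane, so the angle is negated when [y < 0]. *)
have [y0|y0] := leP 0 y.
  exists (acos (x / r)); rewrite /expi; simpc.
  by rewrite c1 s1 ger0_norm.
exists (- acos (x / r)); rewrite /expi cosN sinN; simpc.
by rewrite c1 s1 ltr0_norm// opprK.
Qed.

Lemma normcB (R : realType) (a b : R[i]) : normc (a - b) = normc (b - a).
Proof. by rewrite -(normcN (b - a)) opprB. Qed.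

Lemma ler_normcD (R : realType) (a b : R[i]) : normc (a + b) <= normc a + normc b.
Proof. exact: le_normcD. Qed.

Lemma ler_dist_normcD (R : realType) (c a b : R[i]) :
  normc (a - b) <= normc (a - c) + normc (c - b).
Proof. by have := ler_normcD (a - c) (c - b); rewrite addrA subrK. Qed.

Lemma normc_ge0 (R : realType) (a : R[i]) : 0 <= normc a.
Proof. by case: a => x y; rewrite /normc sqrtr_ge0. Qed.

Lemma normc_real (R : realType) (x : R) : normc x%:C%C = `|x|.
Proof. by rewrite /normc /= expr0n /= addr0 sqrtr_sqr. Qed.

Lemma ler_dist_normc (R : realType) (a b : R[i]) : `|normc a - normc b| <= normc (a - b).
Proof.
have h1 := ler_normcD (a - b) b; have h2 := ler_normcD (b - a) a.
move: h1 h2; rewrite !subrK (normcB b a) => h1 h2.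
by rewrite ler_norml; apply/andP; split; lra.
Qed.

(* If [b <= a], move from [a e] to [b e]: this costs [a - b], itself at most
   the distance on the right. *)
Lemma min_normc_dir (R : realType) (a b : R) (e g : R[i]) :
  0 <= a -> 0 <= b -> normc e = 1 -> normc g = 1 ->
  Num.min a b * normc (e - g) <= 2 * normc (a%:C%C * e - b%:C%C * g).
Proof.
wlog ab : a b e g / b <= a => [H a0 b0 e1 g1|a0 b0 e1 g1].
  have /orP[|] := le_total b a; first by move=> ?; exact: H.
  by move=> ?; rewrite minC normcB (normcB (_ * _)); exact: H.
rewrite (min_idPr ab).
have -> : b * normc (e - g) = normc (b%:C%C * e - b%:C%C * g).
  by rewrite -mulrBr Normc.normcM normc_real ger0_norm.
have h1 := ler_dist_normcD (a%:C%C * e) (b%:C%C * e) (b%:C%C * g).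
have h2 := ler_dist_normc (a%:C%C * e) (b%:C%C * g).
move: h2; rewrite !Normc.normcM !normc_real e1 g1 !mulr1 !ger0_norm ?subr_ge0// => h2.
move: h1; rewrite -mulrBl -rmorphB Normc.normcM normc_real e1 mulr1 distrC ger0_norm ?subr_ge0//.
lra.
Qed.

(** Euclidean division by [k] brings any integer numerator into the range below [k]; the quotient
    only contributes full turns. *)
Lemma roots1_expi (R : realType) (k : nat) (i : int) : (0 < k)%N ->
  roots1 k (expi (2 * pi * (i%:~R / k%:R)) : R[i]).
Proof.
move=> k0; have kz : k%:Z != 0 by rewrite eqz_nat -lt0n.
have k0R : (k%:R : R) != 0 by rewrite pnatr_eq0 -lt0n.
have := divz_eq i k; have := modz_ge0 i kz.
have := ltz_pmod i (_ : 0 < k%:Z); rewrite ltz_nat => /(_ k0).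
case: (modz _ _) => // j jk _ ->; exists j => //.
have -> : 2 * pi * (((i %/ k)%Z * k + j)%:~R / k%:R) =
   2 * pi * (i %/ k)%Z%:~R + 2 * pi * j%:R / k%:R :> R.
  by rewrite intrD intrM; field.
by rewrite expiD expi_int mul1r.
Qed.

Lemma roots1P (R : realType) (k : nat) (z : R[i]) : roots1 k z ->
  exists j : nat, z = expi (2 * pi * (j%:R / k%:R)).
Proof. by case=> j _ <-; exists j; rewrite mulrA. Qed.

Lemma normc_roots1 (R : realType) (k : nat) (z : R[i]) : roots1 k z -> normc z = 1.
Proof. by move=> /roots1P[j ->]; exact: normc_expi. Qed.

(** * Integer division *)

(** Passing from [m] to [m + 1] trades the term [m %/ N] for [(m + N) %/ N], which is one more; all
    other terms are shared. *)
Lemma sum_divz_succ (N : nat) (m : int) : (0 < N)%N ->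
  \sum_(j < N) ((m + 1 + j%:Z) %/ N)%Z = \sum_(j < N) ((m + j%:Z) %/ N)%Z + 1.
Proof.
case: N => // N _; rewrite big_ord_recr [in RHS]big_ord_recl /=.
have -> : (m + 1 + N)%R = (m + 0 + 1 * N.+1%:Z)%R by rewrite -addn1 PoszD; ring.
rewrite divzDr ?dvdz_mull// mulzK// -!addrA; rewrite [RHS]addrC -!addrA.
congr (_ + _); last by rewrite addrC.
by apply: eq_bigr => i _; rewrite /bump /= PoszD addrA.
Qed.

Lemma sum_divzD (N : nat) (m : int) (n : nat) : (0 < N)%N ->
  \sum_(j < N) ((m + n%:Z + j%:Z) %/ N)%Z = \sum_(j < N) ((m + j%:Z) %/ N)%Z + n%:Z.
Proof.
move=> N0; elim: n => [|n IHn]; first by rewrite !addr0.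
by rewrite -addn1 PoszD addrA sum_divz_succ// IHn addrA.
Qed.

(* Hermite's identity for differences. *)
Lemma sum_dist_divz (N : nat) (m n : int) : (0 < N)%N ->
  \sum_(j < N) `|((m + j%:Z) %/ N)%Z - ((n + j%:Z) %/ N)%Z| = `|m - n|.
Proof.
move=> N0; wlog nm : m n / n <= m.
  move=> H; have /orP[/H//|/H] := le_total n m.
  by rewrite distrC => <-; apply: eq_bigr => j _; rewrite distrC.
(* Division by [N] is monotone, so all differences are nonnegative and the absolute values drop. *)
transitivity (\sum_(j < N) (((m + j%:Z) %/ N)%Z - ((n + j%:Z) %/ N)%Z)).
  apply: eq_bigr => j _; rewrite ger0_norm// subr_ge0.
  by apply: lez_pdiv2r => //; rewrite ?lerD2r.
have [d ->] : exists d : nat, m = n + d%:Z.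
  by exists `|m - n|%N; rewrite gez0_abs ?subr_ge0// [RHS]addrC subrK.
by rewrite sumrB sum_divzD// addrAC subrr add0r addrAC subrr add0r.
Qed.

(** Round [(m - n) / M] to a nearest integer. This serves to bring two angles within half a turn, as
    [normc_expiB_ge] requires. *)
Lemma near_modz (M : nat) (m n : int) : (0 < M)%N ->
  exists l : int, `|m - (n + l * M)| *+ 2 <= M.
Proof.
move=> M0; have Mz : M%:Z != 0 by rewrite eqz_nat -lt0n.
have := divz_eq (m - n) M; have := modz_ge0 (m - n) Mz.
have := ltz_pmod (m - n) (_ : 0 < M%:Z); rewrite ltz_nat => /(_ M0).
move: (modz _ _) (divz _ _) => r q rM r0 e.
have [h|h] := leP (r *+ 2) M.
  by exists q; rewrite opprD addrA e addrC addKr ger0_norm.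
exists (q + 1); rewrite opprD addrA e mulrDl mul1r opprD addrA.
rewrite [_ + r]addrC addrK ltr0_norm ?subr_lt0// opprB.
by lia.
Qed.

(** * Edge sums and the coarea inequality *)

Section edge_sums.
Variables (R : realType) (V : finType).
Implicit Types (adj : rel V) (F G : V -> V -> R).

Lemma edge_sumE adj F : edge_sum adj F =
  \sum_(e : V * V | adj e.1 e.2 && (enum_rank e.1 < enum_rank e.2)%N) F e.1 e.2.
Proof. exact: (pair_big_dep xpredT (fun u v => adj u v && (enum_rank u < enum_rank v)%N)). Qed.

Lemma ler_edge_sum adj F G : (forall u v, adj u v -> F u v <= G u v) ->
  edge_sum adj F <= edge_sum adj G.
Proof. by move=> FG; rewrite !edge_sumE; apply: ler_sum => e /andP[/FG]. Qed.

Lemma eq_edge_sum adj F G : (forall u v, adj u v -> F u v = G u v) ->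
  edge_sum adj F = edge_sum adj G.
Proof. by move=> FG; rewrite !edge_sumE; apply: eq_bigr => e /andP[/FG]. Qed.

Lemma edge_sum_ge0 adj F : (forall u v, adj u v -> 0 <= F u v) -> 0 <= edge_sum adj F.
Proof. by move=> F0; rewrite edge_sumE; apply: sumr_ge0 => e /andP[/F0]. Qed.

Lemma edge_sumD adj F G :
  edge_sum adj (fun u v => F u v + G u v) = edge_sum adj F + edge_sum adj G.
Proof. by rewrite !edge_sumE big_split. Qed.

Lemma edge_sumMl adj (c : R) F :
  edge_sum adj (fun u v => c * F u v) = c * edge_sum adj F.
Proof. by rewrite !edge_sumE mulr_sumr. Qed.

Lemma edge_sum_sum adj (I : finType) (F : I -> V -> V -> R) :
  edge_sum adj (fun u v => \sum_i F i u v) = \sum_i edge_sum adj (F i).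
Proof.
by rewrite edge_sumE exchange_big; apply: eq_bigr => i _; rewrite edge_sumE.
Qed.

Lemma edge_sum_restrict (X : {set V}) adj F :
  edge_sum [rel u v | [&& u \in X, v \in X & adj u v]] F =
  edge_sum adj (fun u v => if (u \in X) && (v \in X) then F u v else 0).
Proof.
rewrite !edge_sumE -big_mkcondr; apply: eq_bigl => e /=.
by rewrite andbA -andbA andbC.
Qed.

(** Symmetry makes each edge occur in both orientations, and irreflexivity excludes equal ranks. *)
Lemma sum_adj_edge_sum adj F : simple_graph adj ->
  \sum_u \sum_(v | adj u v) F u v = edge_sum adj (fun u v => F u v + F v u).
Proof.
move=> [adjC adjI]; rewrite edge_sumD.
have -> : edge_sum adj (fun u v => F v u) =
    \sum_u \sum_(v | adj u v && (enum_rank v < enum_rank u)%N) F u v.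
  rewrite /edge_sum (exchange_big_dep xpredT)//=.
  by apply: eq_bigr => u _; apply: eq_bigl => v; rewrite adjC.
rewrite /edge_sum -big_split; apply: eq_bigr => u _ /=.
rewrite (bigID (fun v => (enum_rank u < enum_rank v)%N)) /=; congr (_ + _).
apply: eq_bigl => v; rewrite -leqNgt leq_eqVlt.
case: eqP => [/ord_inj/enum_rank_inj ->|//]; by rewrite adjI.
Qed.

Lemma boundary_edge_sum adj (w : V -> V -> R) (X : {set V}) :
  simple_graph adj -> edge_weight adj w ->
  boundary adj w X = edge_sum adj (fun u v => if (u \in X) != (v \in X) then w u v else 0).
Proof.
move=> hadj hw.
transitivity (\sum_u \sum_(v | adj u v) if (u \in X) && (v \notin X) then w u v else 0).
  rewrite /boundary big_mkcond; apply: eq_bigr => u _.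
  case: (u \in X) => /=; last by rewrite big1.
  by rewrite -big_mkcondr; apply: eq_bigl => v; rewrite andbC.
rewrite sum_adj_edge_sum//; apply: eq_edge_sum => u v /hw[_ wC].
by case: (u \in X) (v \in X) => [] [] /=; rewrite ?addr0 ?add0r.
Qed.

Lemma edge_sum_degree adj (w : V -> V -> R) (g : V -> R) :
  simple_graph adj -> edge_weight adj w ->
  edge_sum adj (fun u v => w u v * (g u + g v)) = \sum_u degree adj w u * g u.
Proof.
move=> hadj hw; under [RHS]eq_bigr do rewrite /degree mulr_suml.
rewrite sum_adj_edge_sum//; apply: eq_edge_sum => u v /hw[_ <-].
by rewrite mulrDr.
Qed.

End edge_sums.

(** * The Cheeger constant and superlevel sets *)

Section cheeger.
Variables (R : realType) (V : finType) (adj : rel V) (w : V -> V -> R) (mu : V -> R).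
Variables (k : nat) (s : V -> V -> R[i]).
Hypotheses (hadj : simple_graph adj) (hw : edge_weight adj w).
Hypotheses (hmu : forall u : V, 0 < mu u) (hk : (0 < k)%N).

Let w_ge0 u v : adj u v -> 0 <= w u v.
Proof. by move=> /hw[/ltW]. Qed.

Lemma frustration_lbound (X : {set V}) (tau : V -> R[i]) :
  0 <= edge_sum [rel u v | [&& u \in X, v \in X & adj u v]]
          (fun u v => w u v * normc (tau u - s u v * tau v)).
Proof.
apply: edge_sum_ge0 => u v /and3P[_ _ uv].
by rewrite mulr_ge0 ?normc_ge0 ?w_ge0.
Qed.

Lemma frustration_ge0 (X : {set V}) : 0 <= frustration adj w k s X.
Proof.
apply: lb_le_inf => [|_ [tau _ <-]]; last exact: frustration_lbound.
(* The constant function 1 witnesses that the set of values is nonempty. *)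
eexists; exists (fun=> expi (2 * pi * (0%:~R / k%:R))); last by [].
by move=> u _; exact: roots1_expi.
Qed.

Lemma frustration_le (X : {set V}) (tau : V -> R[i]) :
  (forall u, u \in X -> roots1 k (tau u)) ->
  frustration adj w k s X <=
  edge_sum adj (fun u v =>
    if (u \in X) && (v \in X) then w u v * normc (tau u - s u v * tau v) else 0).
Proof.
move=> ht; rewrite -edge_sum_restrict; apply: ge_inf; last by exists tau.
by exists 0 => _ [t _ <-]; exact: frustration_lbound.
Qed.

Lemma vol_ge0 (X : {set V}) : 0 <= vol mu X.
Proof. by apply: sumr_ge0 => u _; exact: ltW. Qed.

Lemma boundary_ge0 (X : {set V}) : 0 <= boundary adj w X.
Proof.
rewrite boundary_edge_sum//; apply: edge_sum_ge0 => u v uv.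
by case: ifP; rewrite // w_ge0.
Qed.

Lemma cheeger1_vol (X : {set V}) : X != finset.set0 ->
  cheeger1 adj w mu k s * vol mu X <= frustration adj w k s X + boundary adj w X.
Proof.
move=> X0; have v0 : 0 < vol mu X.
  case/set0Pn: X0 => u uX; rewrite /vol (bigD1 u)//= ltr_wpDr//.
  by apply: sumr_ge0 => v _; exact: ltW.
rewrite -ler_pdivlMr//; apply: ge_inf; last by exists X.
exists 0 => _ [Y _ <-]; apply: divr_ge0; last exact: vol_ge0.
by rewrite addr_ge0 ?frustration_ge0 ?boundary_ge0.
Qed.

(* Layer-cake decomposition: peel off [m] times the indicator of the support of
   [r], where [m] is the least positive value of [r]. *)
Lemma coarea (tau : V -> R[i]) (htau : forall u, roots1 k (tau u)) (r : V -> R)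
    (r0 : forall u, 0 <= r u) :
  cheeger1 adj w mu k s * \sum_u r u * mu u <=
  edge_sum adj (fun u v => w u v *
    (`|r u - r v| + Num.min (r u) (r v) * normc (tau u - s u v * tau v))).
Proof.
have [n] := ubnP #|[set u | r u != 0]|; elim: n r r0 => // n IHn r r0.
set X := [set u | r u != 0]; rewrite ltnS => Xn.
have [Xe|X0] := eqVneq X finset.set0.
  rewrite big1 ?mulr0 => [|u _].
    apply: edge_sum_ge0 => u v uv; rewrite mulr_ge0 ?w_ge0// addr_ge0//.
    by rewrite mulr_ge0 ?normc_ge0// le_min !r0.
  have /eqP : u \notin X by rewrite Xe inE.
  by rewrite inE negbK => /eqP/eqP ->; rewrite mul0r.
case/set0Pn: (X0) => u0 u0X.
case: (@arg_minP _ R V u0 (mem X) r u0X) => u1 u1X' minr; have u1X : u1 \in X := u1X'.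
set m := r u1.
have m0 : 0 < m by rewrite lt_def r0 andbT; move: u1X; rewrite /X inE.
pose r' u := r u - (if u \in X then m else 0).
have r'0 u : 0 <= r' u.
  rewrite /r'; case: ifP => uX; last by rewrite subr0.
  by rewrite subr_ge0 minr.
have X'X : (#|[set u | r' u != 0%R]| < n)%N.
  apply: leq_trans Xn; apply: proper_card; apply/properP; split.
    apply/fintype.subsetP => u; rewrite !inE; apply: contra => /eqP ru.
    by rewrite /r' inE ru eqxx subr0.
  by exists u1; rewrite // inE /r' u1X subrr eqxx.
have := IHn r' r'0 X'X => IH.
have -> : \sum_u r u * mu u = \sum_u r' u * mu u + m * vol mu X.
  rewrite /vol mulr_sumr [X in _ + X]big_mkcond -big_split; apply: eq_bigr => u _ /=.
  by rewrite /r'; case: ifP => _; [rewrite mulrBl subrK|rewrite subr0 addr0].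
have := cheeger1_vol X0; have := frustration_le (fun u _ => htau u) => /(_ X).
rewrite boundary_edge_sum// => h1 h2.
have {}h2 := le_trans h2 (lerD h1 (lexx _)).
rewrite mulrDr mulrCA; apply: le_trans (lerD IH (ler_wpM2l (ltW m0) h2)) _.
rewrite -edge_sumD -edge_sumMl -edge_sumD; apply: ler_edge_sum => u v uv.
have wuv := w_ge0 uv.
set c := normc _.
have rX x : (x \in X) = false -> r x = 0 by rewrite /X inE => /negbFE/eqP.
have mX x : x \in X -> m <= r x by exact: minr.
(* Inside [X], peeling keeps the difference and lowers the minimum by [m]. On a cut edge the minimum
   is 0 before and after, and the difference drops by [m]. Outside [X] nothing changes. *)
rewrite /r'; case: ifPn => [uX|/negbTE uX]; case: ifPn => [vX|/negbTE vX] /=.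
- rewrite addr0 [m * _]mulrCA -mulrDr ler_wpM2l// -addr_minl mulrBl.
  have -> : r u - m - (r v - m) = r u - r v by ring.
  lra.
- rewrite (rX v vX) !subr0 add0r [m * _]mulrC -mulrDr ler_wpM2l//.
  rewrite !(min_idPr _) ?subr_ge0 ?mX// !ger0_norm ?subr_ge0 ?mX//; lra.
- rewrite (rX u uX) !subr0 !sub0r !normrN add0r [m * _]mulrC -mulrDr ler_wpM2l//.
  rewrite !(min_idPl _) ?subr_ge0 ?mX// !ger0_norm ?subr_ge0 ?mX//; lra.
- by rewrite !subr0 addr0 mulr0 addr0.
Qed.

End cheeger.

(** * Averaging over sectors *)

Lemma expi_periodic (R : realType) (k : nat) (i l : int) : (0 < k)%N ->
  expi (2 * pi * ((i + l * k%:Z)%:~R / k%:R)) = expi (2 * pi * (i%:~R / k%:R)) :> R[i].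
Proof.
move=> k0; have kR : (k%:R : R) != 0 by rewrite pnatr_eq0 -lt0n.
have -> : 2 * pi * ((i + l * k%:Z)%:~R / k%:R) =
    2 * pi * (i%:~R / k%:R) + 2 * pi * l%:~R :> R.
  by rewrite intrD intrM -pmulrn; field.
by rewrite expiD expi_int mulr1.
Qed.

(* Rotating the [k] sectors of the circle by [1/N]-fractions of a sector rounds
   an angle [m / (N k)] to [((m + j) %/ N) / k]; averaging over [j] loses at most
   a factor [2]. *)
Lemma sector_average (R : realType) (N k : nat) (m n : int) :
  (0 < N)%N -> (0 < k)%N ->
  \sum_(j < N) normc (expi (2 * pi * (((m + j%:Z) %/ N)%Z%:~R / k%:R))
                    - expi (2 * pi * (((n + j%:Z) %/ N)%Z%:~R / k%:R)) : R[i])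
  <= N%:R * (2 * normc (expi (2 * pi * (m%:~R / (N * k)%:R))
                       - expi (2 * pi * (n%:~R / (N * k)%:R)) : R[i])).
Proof.
move=> N0 k0.
have NR : 0 < N%:R :> R by rewrite ltr0n.
have kR : 0 < k%:R :> R by rewrite ltr0n.
have Nz : N%:Z != 0 by rewrite eqz_nat -lt0n.
have M0 : (0 < N * k)%N by rewrite muln_gt0 N0.
(* Replace [n] by a congruent [n'] within half a turn of [m]. Adding [l * (N * k)] shifts every
   rounded value by [l * k], so no exponential changes. *)
have [l hl] := near_modz m n M0.
set n' := n + l * (N * k)%N in hl.
have expi_shift (j : 'I_N) :
    expi (2 * pi * (((n + j%:Z) %/ N)%Z%:~R / k%:R)) =
    expi (2 * pi * (((n' + j%:Z) %/ N)%Z%:~R / k%:R)) :> R[i].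
  have -> : n' + j%:Z = (l * k%:Z) * N%:Z + (n + j%:Z) by rewrite /n' PoszM; ring.
  by rewrite divzMDl// [l * _ + _]addrC expi_periodic.
have expi_shift' : expi (2 * pi * (n%:~R / (N * k)%:R)) =
    expi (2 * pi * (n'%:~R / (N * k)%:R)) :> R[i].
  by rewrite /n' expi_periodic.
rewrite expi_shift'; under eq_bigr do rewrite expi_shift.
have pi0 := @pi_gt0 R.
(* Bound each chord by its arc; Hermite's identity then sums the arcs exactly, and [normc_expiB_ge]
   returns from arc to chord. *)
apply: (@le_trans _ _ (\sum_(j < N) 2 * pi / k%:R *
    (`|((m + j%:Z) %/ N)%Z - ((n' + j%:Z) %/ N)%Z|%:~R))).
  apply: ler_sum => j _; apply: le_trans (normc_expiB_le _ _) _.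
  have -> : 2 * pi * (((m + j) %/ N)%Z%:~R / k%:R) - 2 * pi * (((n' + j) %/ N)%Z%:~R / k%:R)
    = 2 * pi / k%:R * (((m + j) %/ N)%Z - ((n' + j) %/ N)%Z)%:~R :> R.
    by rewrite rmorphB /=; field; rewrite gt_eqF.
  by rewrite normrM ger0_norm ?intr_norm// !mulr_ge0 ?invr_ge0// ltW.
rewrite -mulr_sumr -rmorph_sum /= sum_dist_divz//.
have {hl}hd : 2 * `|m - n'|%:~R <= N%:R * k%:R :> R.
  by have := hl; rewrite -(ler_int R) rmorphMn /= -[_ *+ 2]mulr_natl -pmulrn natrM.
have dE : `|2 * pi * (m%:~R / (N * k)%:R) - 2 * pi * (n'%:~R / (N * k)%:R)|
    = 2 * pi / (N%:R * k%:R) * `|m - n'|%:~R :> R.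
  have -> : 2 * pi * (m%:~R / (N * k)%:R) - 2 * pi * (n'%:~R / (N * k)%:R) =
     2 * pi / (N%:R * k%:R) * (m - n')%:~R :> R.
    by rewrite natrM rmorphB /=; field; rewrite !gt_eqF.
  by rewrite normrM ger0_norm ?intr_norm// ?mulr_ge0 ?invr_ge0 ?mulr_ge0// ltW.
have := @normc_expiB_ge R (2 * pi * (m%:~R / (N * k)%:R)) (2 * pi * (n'%:~R / (N * k)%:R)).
rewrite dE => H; have /H : 2 * pi / (N%:R * k%:R) * `|m - n'|%:~R <= pi :> R.
  rewrite mulrAC ler_pdivrMr ?mulr_gt0//.
  by rewrite (mulrC 2) -mulrA ler_pM2l.
rewrite -(ler_pM2l NR); apply: le_trans.
by rewrite le_eqVlt; apply/orP; left; apply/eqP; field; rewrite !gt_eqF.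
Qed.

Lemma expi_floor (R : realType) (M : nat) (t : R) : (0 < M)%N ->
  normc (expi t - expi (2 * pi * ((Num.floor (M%:R * t / (2 * pi)))%:~R / M%:R))) <=
  2 * pi / M%:R.
Proof.
move=> M0; have MR : 0 < M%:R :> R by rewrite ltr0n.
have pi0 := @pi_gt0 R; set x := M%:R * t / (2 * pi).
apply: le_trans (normc_expiB_le _ _) _.
have -> : t - 2 * pi * ((Num.floor x)%:~R / M%:R) = 2 * pi / M%:R * (x - (Num.floor x)%:~R).
  by rewrite /x; move: (pi : R) pi0 => P P0; field; rewrite !gt_eqF.
have h1 := floor_le_tmp x; have h2 := floorD1_gt x.
have c0 : 0 <= 2 * pi / M%:R :> R by rewrite divr_ge0 ?mulr_ge0 ?(ltW pi0) ?(ltW MR).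
rewrite normrM (ger0_norm c0) ler_piMr//.
by rewrite ger0_norm ?subr_ge0// lerBlDl ltW// -intrD1.
Qed.

(** Otherwise [N%:R * (a - b)] would exceed the fixed error [K] for large [N]. *)
Lemma le_of_archi (R : realType) (a b K : R) :
  (forall N : nat, (0 < N)%N -> N%:R * a <= N%:R * b + K) -> a <= b.
Proof.
move=> h; rewrite leNgt; apply/negP => ba.
have d0 : 0 < a - b by rewrite subr_gt0.
have [N hN] : exists N : nat, `|K| / (a - b) < N%:R.
  by exists (Num.bound (`|K| / (a - b))); rewrite archi_boundP// divr_ge0// ltW.
have N0 : (0 < N)%N.
  by rewrite -(ltr0n R); apply: le_lt_trans hN; rewrite divr_ge0// ltW.
move: hN; rewrite ltr_pdivrMr// => hN.
have := h N N0; have := ler_norm K; lra.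
Qed.

(* The rounding of the angles to multiples of [2 pi / (N k)] costs an error of
   order [1 / N], which disappears as [N] tends to infinity. *)
Lemma poincare1 (R : realType) (V : finType) (adj : rel V)
    (w : V -> V -> R) (mu : V -> R) (k : nat) (s : V -> V -> R[i])
    (hadj : simple_graph adj) (hw : edge_weight adj w)
    (hmu : forall u : V, 0 < mu u)
    (hk : (0 < k)%N) (hs : signature adj k s) (f : V -> R[i]) :
  cheeger1 adj w mu k s * \sum_u normc (f u) * mu u <=
  5 * edge_sum adj (fun u v => w u v * normc (f u - s u v * f v)).
Proof.
pose t u := xget 0 [set t | f u = (normc (f u))%:C%C * expi t]%classic.
have ft u : f u = (normc (f u))%:C%C * expi (t u).
  by have [x fx] := polar (f u); rewrite /t; case: xgetP => [y _ //|/(_ x)].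
pose r u := normc (f u); have r0 u : 0 <= r u by exact: normc_ge0.
(* The total rounding error: [2 * pi / (N * k)] at each of the two endpoints, times the factor 2 of
   [sector_average], times [N] rotations. *)
pose K := edge_sum adj (fun u v => w u v * (Num.min (r u) (r v) * (8 * pi / k%:R))).
apply: (@le_of_archi _ _ _ K) => N N0.
have M0 : (0 < N * k)%N by rewrite muln_gt0 N0.
have NR : 0 < N%:R :> R by rewrite ltr0n.
have kR : 0 < k%:R :> R by rewrite ltr0n.
pose n u := Num.floor ((N * k)%:R * t u / (2 * pi)).
pose tau (j : 'I_N) u : R[i] := expi (2 * pi * (((n u + j%:Z) %/ N)%Z%:~R / k%:R)).
have H (j : 'I_N) : cheeger1 adj w mu k s * \sum_u r u * mu u <= _ :=
  coarea s hadj hw hmu hk (fun u => roots1_expi R ((n u + j%:Z) %/ N)%Z hk) r0.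
have := @ler_sum R _ (index_enum 'I_N) xpredT _ _ (fun j _ => H j).
rewrite sumr_const card_ord -[_ *+ N]mulr_natl => /le_trans; apply.
rewrite -edge_sum_sum mulrA -edge_sumMl -edge_sumD.
apply: ler_edge_sum => u v uv; have [wuv _] := hw _ _ uv.
rewrite -mulr_sumr big_split /= sumr_const card_ord -[_ *+ N]mulr_natl -mulr_sumr.
rewrite [N%:R * 5 * _]mulrCA -mulrDr ler_pM2l//.
have [suv _] := hs _ _ uv; have [a sE] := roots1P suv.
set m := Num.min _ _.
have m0 : 0 <= m by rewrite le_min !r0.
set M := (N * k)%N in M0 *.
have MR : 0 < M%:R :> R by rewrite ltr0n.
pose e u : R[i] := expi (2 * pi * ((n u)%:~R / M%:R)).
have eE x : normc (expi (t x) - e x) <= 2 * pi / M%:R by exact: expi_floor.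
(* Multiplication by [s u v] turns by [a] whole sectors: it adds [a * N] to the numerator [n v] and
   so commutes with every rounding. *)
have avg : \sum_(j < N) normc (tau j u - s u v * tau j v) <=
    N%:R * (2 * normc (e u - s u v * e v)).
  have := sector_average R (n u) (n v + a%:Z * N%:Z) N0 hk.
  have -> : expi (2 * pi * ((n v + a%:Z * N%:Z)%:~R / M%:R)) = s u v * e v :> R[i].
    rewrite sE -expiD; congr expi.
    by rewrite intrD intrM -!pmulrn natrM; field; rewrite !gt_eqF.
  apply: le_trans; apply: ler_sum => j _.
  rewrite sE /tau -expiD le_eqVlt; apply/orP; left; apply/eqP.
  congr (normc (_ - expi _)).
  have -> : (n v + a%:Z * N%:Z + j%:Z) = (a%:Z * N%:Z + (n v + j%:Z)) by ring.
  rewrite divzMDl; last by rewrite eqz_nat -lt0n.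
  by rewrite intrD -!pmulrn; field; rewrite gt_eqF.
have e1 : normc (s u v) = 1 by exact: normc_roots1 suv.
have dist : normc (e u - s u v * e v) <=
    normc (expi (t u) - s u v * expi (t v)) + 4 * pi / M%:R.
  have h1 := ler_dist_normcD (expi (t u)) (e u) (s u v * e v).
  have h2 := ler_dist_normcD (s u v * expi (t v)) (expi (t u)) (s u v * e v).
  have h3 := eE u; have h4 := eE v; rewrite normcB in h3.
  move: h2; rewrite -mulrBr Normc.normcM e1 mul1r => h2.
  lra.
have dir : m * normc (expi (t u) - s u v * expi (t v)) <= 2 * normc (f u - s u v * f v).
  have := @min_normc_dir R (r u) (r v) (expi (t u)) (s u v * expi (t v)) (r0 u) (r0 v).
  rewrite Normc.normcM e1 !normc_expi mulr1 [in X in _ -> X](ft u) [in X in _ -> X](ft v).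
  by rewrite [s u v * (_ * _)]mulrCA; apply.
have diff : `|r u - r v| <= normc (f u - s u v * f v).
  by have := ler_dist_normc (f u) (s u v * f v); rewrite Normc.normcM e1 mul1r.
(* The constant is 5 = 1 + 2 * 2: 1 from [diff], one factor 2 from [avg] and one from [dir]. *)
apply: le_trans (lerD (ler_wpM2l (ltW NR) diff) (ler_wpM2l m0 avg)) _.
have dist' := ler_wpM2l (ltW NR) (ler_wpM2l m0 dist).
have dir' := ler_wpM2l (ltW NR) dir.
have pE : N%:R * (m * (4 * pi / M%:R)) = m * (8 * pi / k%:R) / 2 :> R.
  rewrite natrM; move: (pi : R) => P; field; by rewrite !gt_eqF.
rewrite mulrDr mulrDr pE in dist'.
rewrite mulrCA [m * (2 * _)]mulrCA mulrCA.
move: dist' dir'; set x := _ * (m * _); set y := _ * (m * _); lra.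
Qed.

(** * General exponents *)

(** Young's inequality for the exponents [p] and [p / (p - 1)], multiplied by [p] so that it also
    makes sense at [p = 1]. *)
Lemma young_powR (R : realType) (p a b : R) : 1 <= p -> 0 <= a -> 0 <= b ->
  p * (b * a `^ (p - 1)) <= b `^ p + (p - 1) * a `^ p.
Proof.
rewrite le_eqVlt => /predU1P[<- a0 b0|p1 a0 b0].
  by rewrite subrr powRr0 !powRr1// mulr1 !mul1r mul0r addr0.
have p0 : 0 < p by lra.
have q0 : 0 < p - 1 by lra.
have := @conjugate_powR R b (a `^ (p - 1)) p (p / (p - 1)) b0 (powR_ge0 _ _) p0 (divr_gt0 p0 q0).
have -> : p^-1 + (p / (p - 1))^-1 = 1 by field; rewrite !gt_eqF.
move=> /(_ erefl); rewrite -powRrM (mulrC (p - 1)) divfK ?gt_eqF// => h.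
apply: le_trans (ler_wpM2l (ltW p0) h) _.
by rewrite le_eqVlt; apply/orP; left; apply/eqP; field; rewrite !gt_eqF.
Qed.

(** Keeps the argument of [z] and thus commutes with multiplication by numbers of modulus 1, in
    particular by the signature. *)
Definition powc (R : realType) (p : R) (z : R[i]) : R[i] := (normc z `^ (p - 1))%:C%C * z.

Lemma normc_powc (R : realType) (p : R) (z : R[i]) : 1 <= p -> normc (powc p z) = normc z `^ p.
Proof.
move=> p1; rewrite /powc Normc.normcM normc_real ger0_norm ?powR_ge0//.
by rewrite mulrC mulr_powRB1 ?normc_ge0//; lra.
Qed.

Lemma powc_lipschitz (R : realType) (p : R) (z z' : R[i]) : 1 <= p ->
  normc (powc p z - powc p z') <=
  p * (normc (z - z') * Num.max (normc z) (normc z') `^ (p - 1)).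
Proof.
move=> p1; wlog ab : z z' / normc z' <= normc z.
  move=> H; have /orP[|] := le_total (normc z') (normc z); first exact: H.
  by move=> /H; rewrite normcB (normcB z') maxC.
rewrite (max_idPl ab).
have [a0 b0] := (normc_ge0 z, normc_ge0 z').
have Y := young_powR p1 a0 b0.
rewrite -!(@mulr_powRB1 _ _ p) ?normc_ge0//  in Y; try lra.
have AB : normc z' `^ (p - 1) <= normc z `^ (p - 1).
  by apply: ge0_ler_powR; rewrite ?nnegrE//; lra.
have dz := ler_dist_normc z z'; rewrite ger0_norm ?subr_ge0// in dz.
(* With A and B the powers of [normc z] and [normc z'], Young's inequality [Y] bounds (A - B)|z'| by
   (p - 1) A (|z| - |z'|), so both terms together give the factor p A. *)
have -> : powc p z - powc p z' = (normc z `^ (p - 1))%:C%C * (z - z') +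
    (normc z `^ (p - 1) - normc z' `^ (p - 1))%:C%C * z'.
  by rewrite /powc rmorphB /=; ring.
apply: le_trans (ler_normcD _ _) _.
rewrite !Normc.normcM !normc_real !ger0_norm ?subr_ge0 ?powR_ge0//.
have A0 := powR_ge0 (normc z) (p - 1).
have : (p - 1) * normc z `^ (p - 1) * (normc z - normc z') <=
       (p - 1) * normc z `^ (p - 1) * normc (z - z').
  by apply: ler_wpM2l => //; rewrite mulr_ge0// subr_ge0.
move: Y A0 AB dz; move: (normc z) (normc z') (normc _) (_ `^ _) (_ `^ _) => a b c A B; lra.
Qed.

Lemma powR_exponent_compl (R : realType) (x a : R) : 0 < x -> x `^ a * x `^ (1 - a) = x.
Proof.
move=> x0; rewrite -powRD ?(gt_eqF x0) ?implybT//.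
by rewrite [a + _]addrC subrK powRr1// ltW.
Qed.

(* Optimal choice of the scaling [l] in Young's inequality. *)
Lemma hoelder_of_young (R : realType) (p S D Q : R) : 1 <= p -> 0 <= D -> 0 <= Q ->
  (forall l, 0 < l -> p * (l * S) <= l `^ p * D + (p - 1) * Q) ->
  S <= D `^ (1 / p) * Q `^ (1 - 1 / p).
Proof.
rewrite !div1r => p1 D0 Q0 h; have p0 : 0 < p by lra.
have [pe|pn] := eqVneq p 1.
  move: (h 1 ltr01); rewrite pe powR1 invr1 subrr powRr0 powRr1//; lra.
have {p1 pn}p1 : 0 < p - 1 by rewrite subr_gt0 lt_def pn.
have pV1 : 0 < 1 - p^-1.
  by rewrite subr_gt0 invf_lt1//; lra.
have [De|Dn] := eqVneq D 0.
  rewrite De powR0 ?invr_eq0 ?gt_eqF// mul0r leNgt; apply/negP => S0.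
  (* With [D = 0] the left side grows linearly in [l] against a fixed bound; this [l] is large
     enough. *)
  have l0 : 0 < (p * Q + 1) / S by rewrite divr_gt0// ltr_wpDl// mulr_ge0// ltW.
  have := h _ l0; rewrite De mulr0 add0r divfK ?gt_eqF// => hh.
  have : p * Q <= p * (p * Q) by rewrite ler_peMl ?mulr_ge0 ?(ltW p0)//; lra.
  lra.
have {Dn}Dp : 0 < D by rewrite lt_def Dn.
have [Qe|Qn] := eqVneq Q 0.
  rewrite Qe powR0 ?gt_eqF// mulr0 leNgt; apply/negP => S0.
  (* Chosen so that [l ^ p * D = l * S], which contradicts [p > 1]. *)
  have l0 : 0 < (S / D) `^ (p - 1)^-1 by rewrite powR_gt0// divr_gt0.
  have := h _ l0; rewrite Qe mulr0 addr0 -(@mulr_powRB1 _ _ p) ?(ltW l0)//.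
  rewrite -[X in _ * X * D]powRrM mulVf ?gt_eqF// powRr1 ?divr_ge0 ?(ltW S0)//.
  rewrite -mulrA divfK ?gt_eqF// ger_pMl ?mulr_gt0//; lra.
have {Qn}Qp : 0 < Q by rewrite lt_def Qn.
(* The optimum: [l ^ p * D = Q], so the hypothesis reads [l * S <= Q]. *)
have l0 : 0 < (Q / D) `^ p^-1 by rewrite powR_gt0// divr_gt0.
have := h _ l0; rewrite -[X in X * D]powRrM mulVf ?gt_eqF// powRr1 ?divr_ge0//.
rewrite divfK ?gt_eqF// => hl.
rewrite -(ler_pM2l l0) mulrA -powRM ?divr_ge0// divfK ?gt_eqF//.
rewrite powR_exponent_compl//.
by rewrite -(ler_pM2l p0); lra.
Qed.

Lemma poincare (R : realType) (V : finType) (adj : rel V)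
    (w : V -> V -> R) (mu : V -> R) (k : nat) (s : V -> V -> R[i]) (p : R)
    (hadj : simple_graph adj) (hw : edge_weight adj w)
    (hmu : forall u : V, 0 < mu u)
    (hk : (0 < k)%N) (hs : signature adj k s)
    (hp : 1 <= p) (f : V -> R[i]) :
  cheeger1 adj w mu k s * (\sum_(u : V) (normc (f u) `^ p) * mu u) `^ (1 / p)
  <= 5 * p * (max_degree adj w mu `^ (1 - 1 / p))
     * (edge_sum adj (fun u v => w u v * (normc (f u - s u v * f v) `^ p))) `^ (1 / p).
Proof.
have p0 : 0 < p by lra.
set h := cheeger1 _ _ _ _ _; set X := \sum_u _; set d := max_degree _ _ _.
set D := edge_sum _ _.
pose dist u v := normc (f u - s u v * f v).
pose M u v := Num.max (normc (f u)) (normc (f v)).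
pose S := edge_sum adj (fun u v => w u v * (dist u v * M u v `^ (p - 1))).
pose Q := edge_sum adj (fun u v => w u v * M u v `^ p).
have M0 u v : 0 <= M u v by rewrite le_max normc_ge0.
have w0 u v : adj u v -> 0 <= w u v by move=> /hw[/ltW].
have X0 : 0 <= X by apply: sumr_ge0 => u _; rewrite mulr_ge0 ?powR_ge0 ?ltW.
have D0 : 0 <= D by apply: edge_sum_ge0 => u v uv; rewrite mulr_ge0 ?powR_ge0 ?w0.
have Q0 : 0 <= Q by apply: edge_sum_ge0 => u v uv; rewrite mulr_ge0 ?powR_ge0 ?w0.
have d0 : 0 <= d by exact: bigmax_ge_id.
(* The case [p = 1] for [powc p (f u)]; the Lipschitz bound turns its right side into [S]. *)
have hXS : h * X <= 5 * p * S.
  have := @poincare1 R V adj w mu k s hadj hw hmu hk hs (fun u => powc p (f u)).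
  under eq_bigr do rewrite normc_powc//.
  move=> /le_trans; apply; rewrite -mulrA ler_pM2l// /S -edge_sumMl.
  apply: ler_edge_sum => u v uv; rewrite [p * _]mulrCA ler_wpM2l ?w0//.
  have [suv _] := hs _ _ uv; have s1 := normc_roots1 suv.
  have -> : s u v * powc p (f v) = powc p (s u v * f v).
    by rewrite /powc Normc.normcM s1 mul1r mulrCA.
  apply: le_trans (powc_lipschitz _ _ hp) _.
  by rewrite Normc.normcM s1 mul1r.
have hS : S <= D `^ (1 / p) * Q `^ (1 - 1 / p).
  apply: hoelder_of_young => // l l0.
  rewrite /S /D /Q -!edge_sumMl -edge_sumD; apply: ler_edge_sum => u v uv.
  have := young_powR hp (M0 u v) (mulr_ge0 (ltW l0) (normc_ge0 (f u - s u v * f v))).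
  rewrite powRM ?(ltW l0) ?normc_ge0// => /(ler_wpM2l (w0 _ _ uv)).
  rewrite /dist; move: (normc _) => a; move: (_ `^ p) (_ `^ p) => *; lra.
(* The power of a maximum is at most the sum of the powers; regrouping by vertices gives degrees,
   each at most [d * mu u]. *)
have hQ : Q <= d * X.
  apply: (@le_trans _ _ (edge_sum adj
      (fun u v => w u v * (normc (f u) `^ p + normc (f v) `^ p)))).
    apply: ler_edge_sum => u v uv; rewrite ler_wpM2l ?w0// /M.
    by case: (leP (normc (f u)) (normc (f v))) => _; rewrite ?lerDl ?lerDr powR_ge0.
  rewrite (edge_sum_degree (fun u => normc (f u) `^ p))// mulr_sumr.
  apply: ler_sum => u _; rewrite [d * _]mulrCA [X in X <= _]mulrC ler_wpM2l ?powR_ge0//.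
  by rewrite -ler_pdivrMr//; exact: (le_bigmax 0 (fun u => degree adj w u / mu u)).
have [Xe|Xn] := eqVneq X 0.
  have -> : X `^ (1 / p) = 0 by rewrite Xe powR0// div1r invr_eq0 gt_eqF.
  rewrite mulr0; apply: mulr_ge0 (powR_ge0 _ _).
  by apply: mulr_ge0 (powR_ge0 _ _); apply: mulr_ge0 (ltW p0).
have Xp : 0 < X by rewrite lt_def Xn.
have e0 : 0 <= 1 - 1 / p by rewrite subr_ge0 div1r invf_le1.
have hX : h * X <= 5 * p * (D `^ (1 / p) * (d `^ (1 - 1 / p) * X `^ (1 - 1 / p))).
  apply: le_trans hXS _; rewrite ler_wpM2l ?mulr_ge0 ?(ltW p0)//.
  apply: le_trans hS _; rewrite ler_wpM2l ?powR_ge0// -powRM//.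
  by apply: ge0_ler_powR; rewrite ?nnegrE ?mulr_ge0.
(* Multiplying by the positive factor X^(1 - 1/p) turns the left side into [h * X], so that the goal
   becomes [hX]. *)
rewrite -(ler_pM2r (powR_gt0 (1 - 1 / p) Xp)) -[h * _ * _]mulrA powR_exponent_compl//.
by apply: le_trans hX _; rewrite (mulrCA (D `^ _)) !mulrA.
Qed.

Unset Implicit Arguments.

Theorem theorem3p10 (R : realType) (V : finType) (adj : rel V)
    (w : V -> V -> R) (mu : V -> R) (k : nat) (s : V -> V -> R[i]) (p : R)
    (hadj : simple_graph adj) (hw : edge_weight adj w)
    (hmu : forall u : V, 0 < mu u)
    (hk : (0 < k)%N) (hs : signature adj k s)
    (hh : 0 < cheeger1 adj w mu k s) (hp : 1 <= p) (f : V -> R[i]) :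
  (\sum_(u : V) (Normc.normc (f u) `^ p) * mu u) `^ (1 / p)
  <= 6 * p * (max_degree adj w mu `^ (1 - 1 / p)) / cheeger1 adj w mu k s
     * (edge_sum adj (fun u v => w u v * (Normc.normc (f u - s u v * f v) `^ p)))
         `^ (1 / p).
Proof.
rewrite mulrAC ler_pdivlMr// mulrC.
(* This bound has the constant 5; it remains to compare 5 with 6 against a nonnegative factor. *)
apply: le_trans (poincare hadj hw hmu hk hs hp f) _.
rewrite -!mulrA ler_wpM2r//; last by rewrite ler_nat.
apply: mulr_ge0; first exact: le_trans hp.
by apply: mulr_ge0; exact: powR_ge0.
Qed.
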